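(* Let $S$ be the chosen finite-dimensional smooth parameter manifold and assume that $\mathscr X_{\mathrm{core}}$ is a Banach manifold in a neighbourhood of $a_0=\mathcal A_{E,\mathrm{core}}(p_0)$. Assume that $\mathcal D_{g_0}=D_{p_0}\mathcal A_{E,\mathrm{core}}:T_{p_0}S\to T_{a_0}\mathscr X_{\mathrm{core}}$ is injective. Then, after shrinking $S$ around $p_0$, the map $\mathcal A_{E,\mathrm{core}}$ is a smooth embedding onto its image. Consequently, the parameter point $p\in S$ is locally determined by its core analytical package. If the parameterization $p\mapsto g_p$ is locally injective (in particular, on an immersed family after shrinking to an embedded neighbourhood), the corresponding Einstein metric is locally uniquely determined as well. (Neither conclusion is global.)
   Context: $S$ is a smooth finite-dimensional manifold parameterizing a smooth family $p\mapsto g_p$ of normalized cohomogeneity-one Einstein metrics ($\operatorname{Ric}(g_p)=\lambda g_p$, $\lambda>0$ fixed, invariant under a fixed Lie group action, normalized by a fixed unit-speed normal geodesic) on a compact manifold $M$, with $g_{p_0}=g_0$ the reference metric. Fixed probe data are given: a compact Riemannian target $(N,h)$ with compatible group action, an equivariant homotopy class of maps $M\to N$ with endpoint, smoothness and normalization conditions, and a reference harmonic map $f_0$ for $g_0$. Under normalized Jacobi nondegeneracy (the linearization at $f_0$ of the tension field in the map variable, between the constrained equivariant $C^{k+2,\alpha}$ and $C^{k,\alpha}$ Hölder spaces, $k\ge4$, $0<\alpha<1$, is an isomorphism) and after shrinking $S$ around $p_0$, each $g_p$ has a unique harmonic map $f_p$ near $f_0$, depending smoothly on $p$; $J_p$ denotes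 the linearization at $f_p$ of the tension field $f\mapsto\tau_{g_p}(f)$, which is invertible, and $G_p=J_p^{-1}$. The (descended) core analytical package is the smooth map $\mathcal A_{E,\mathrm{core}}:S\to\mathscr X_{\mathrm{core}}$, $p\mapsto(J_p,G_p)$, where (after fixed local trivializations) $\mathscr X_{\mathrm{core}}$ is a space of operator data. $\mathcal D_{g_0}$ is called the universal response differential. *)

(* Defs.v *)
From HB Require Import structures.
From mathcomp Require Import all_boot all_order all_algebra.
From mathcomp Require Import all_classical all_reals all_analysis.

Set Implicit Arguments.
Unset Strict Implicit.
Unset Printing Implicit Defensive.

Import Order.TTheory GRing.Theory Num.Theory.
Import numFieldNormedType.Exports.

Local Open Scope classical_set_scope.
Local Open Scope ring_scope.

(** * Smooth maps and manifolds modelled on normed spaces *)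

(* [Ck n U f]: f is n times continuously differentiable on the open set U.
   The derivative is encoded by the tangent map (x, v) |-> 'd f x v, required
   to be C^n jointly in (x, v); between finite-dimensional spaces this is the
   usual class C^n, and between Banach spaces [smooth_on] is the usual
   (Frechet) class C^oo. *)
Fixpoint Ck (n : nat) {R : realType} {V W : normedModType R}
    (U : set V) (f : V -> W) : Prop :=
  match n with
  | 0%N => forall x, U x -> {for x, continuous f}
  | n'.+1 => (forall x, U x -> differentiable f x) /\
      Ck n' (U `*` [set: V]) (fun z : V * V => 'd f (z.1) z.2)
  end.

Definition smooth_on {R : realType} {V W : normedModType R}
  (U : set V) (f : V -> W) : Prop := forall n, Ck n U f.

(* A smooth atlas, with model space V, on the open subset O of T.
   [point c] is the inverse of the chart [coord c]; its values outside
   [coord c @` dom c] are irrelevant. *)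
Record atlas {R : realType} (T : topologicalType) (V : normedModType R)
    (O : set T) := Atlas {
  idx : Type;
  dom : idx -> set T;
  coord : idx -> T -> V;
  point : idx -> V -> T;
  atlas_open : open O;
  dom_open : forall c, open (dom c);
  dom_sub : forall c, dom c `<=` O;
  dom_cover : forall x, O x -> exists c, dom c x;
  img_open : forall c, open (coord c @` dom c);
  coordK : forall c x, dom c x -> point c (coord c x) = x;
  coord_continuous : forall c x, dom c x -> {for x, continuous (coord c)};
  point_continuous : forall c y, (coord c @` dom c) y ->
    {for y, continuous (point c)};
  transition_smooth : forall c d,
    smooth_on (coord c @` (dom c `&` dom d)) (coord d \o point c)
}.

Arguments dom {R T V O} _ _ _.
Arguments coord {R T V O} _ _ _.
Arguments point {R T V O} _ _ _.

Section smooth_maps.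
Context {R : realType} {T1 T2 T3 : topologicalType}.
Context {V1 V2 V3 : normedModType R} {O1 : set T1} {O2 : set T2} {O3 : set T3}.
Variables (A1 : atlas V1 O1) (A2 : atlas V2 O2) (A3 : atlas V3 O3).

Definition local_rep (f : T1 -> T2) (c : idx A1) (d : idx A2) : V1 -> V2 :=
  coord A2 d \o f \o point A1 c.

Definition chart_dom (f : T1 -> T2) (c : idx A1) (d : idx A2) : set V1 :=
  coord A1 c @` (dom A1 c `&` f @^-1` dom A2 d).

(* When O1 or O2 is not the whole space, this is smoothness on the part of O1
   that f sends to O2. *)
Definition smooth_map (f : T1 -> T2) : Prop :=
  continuous f /\ forall c d, smooth_on (chart_dom f c d) (local_rep f c d).

Definition smooth_map2 (f : T1 -> T2 -> T3) : Prop :=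
  continuous (fun z : T1 * T2 => f z.1 z.2) /\
  forall c1 c2 d, smooth_on
    [set z : V1 * V2 | exists x1 x2,
       [/\ dom A1 c1 x1, dom A2 c2 x2, dom A3 d (f x1 x2),
           z.1 = coord A1 c1 x1 & z.2 = coord A2 c2 x2]]
    (fun z => coord A3 d (f (point A1 c1 z.1) (point A2 c2 z.2))).

(* Injectivity of the differential T_x T1 -> T_(f x) T2, read in charts. *)
Definition injective_differential (f : T1 -> T2) (x : T1) : Prop :=
  forall c d, dom A1 c x -> dom A2 d (f x) ->
    injective ('d (local_rep f c d) (coord A1 c x) : V1 -> V2).

(* Injective differential whose image is closed and complemented, i.e. which
   has a continuous linear left inverse. *)
Definition split_injective_differential (f : T1 -> T2) (x : T1) : Prop :=
  forall c d, dom A1 c x -> dom A2 d (f x) ->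
    exists L : {linear V2 -> V1}, continuous L /\
      forall v, L ('d (local_rep f c d) (coord A1 c x) v) = v.

(* f restricted to the open set U is an immersion into the manifold O2 and a
   homeomorphism onto its image. *)
Definition smooth_embedding_on (U : set T1) (f : T1 -> T2) : Prop :=
  [/\ f @` U `<=` O2,
      forall x, U x -> {for x, continuous f},
      forall c d, smooth_on
        (coord A1 c @` (U `&` dom A1 c `&` f @^-1` dom A2 d)) (local_rep f c d),
      forall x, U x -> split_injective_differential f x &
      exists h : T2 -> T1,
        (forall x, U x -> h (f x) = x) /\ {within f @` U, continuous h}].

End smooth_maps.

Definition smooth_curve {R : realType} {T : topologicalType}
    {V : normedModType R} {O : set T} (A : atlas V O) (gam : R -> T) : Prop :=
  continuous gam /\
  forall c, smooth_on (gam @^-1` dom A c : set R^o) (coord A c \o gam).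

Notation manifold R T n := (atlas 'rV[R]_n [set: T]).

(* Matrix of the differential of f at x in the charts c and d, acting on the
   right on row vectors. *)
Definition Dmx {R : realType} {T1 T2 : topologicalType} {m n : nat}
    {O1 : set T1} {O2 : set T2}
    (A1 : atlas 'rV[R]_m O1) (A2 : atlas 'rV[R]_n O2)
    (f : T1 -> T2) (c : idx A1) (d : idx A2) (x : T1) : 'M[R]_(m, n) :=
  'J (local_rep f c d) (coord A1 c x).

(** * Riemannian geometry in local coordinates *)

Section local_geometry.
Context {R : realType}.

Definition partial {n : nat} {W : normedModType R} (i : 'I_n)
  (u : 'rV[R]_n -> W) : 'rV[R]_n -> W := fun y => 'D_(delta_mx 0 i) u y.

(* Christoffel symbol Gamma^k_ij *)
Definition christoffel {n : nat} (g : 'rV[R]_n -> 'M[R]_n) (k i j : 'I_n)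
    (y : 'rV[R]_n) : R^o :=
  2^-1 * \sum_l invmx (g y) k l *
    (partial i (fun z => g z j l : R^o) y + partial j (fun z => g z i l : R^o) y
     - partial l (fun z => g z i j : R^o) y).

Definition ricci {n : nat} (g : 'rV[R]_n -> 'M[R]_n) (i j : 'I_n)
    (y : 'rV[R]_n) : R :=
  let Gam := christoffel g in
  \sum_k (partial k (Gam k i j) y - partial j (Gam k i k) y) +
  \sum_k \sum_l (Gam k k l y * Gam l i j y - Gam k j l y * Gam l i k y).

Definition tension {m n : nat} (g : 'rV[R]_m -> 'M[R]_m)
    (h : 'rV[R]_n -> 'M[R]_n) (u : 'rV[R]_m -> 'rV[R]_n) (y : 'rV[R]_m) :
    'rV[R]_n :=
  let du (a : 'I_n) (i : 'I_m) := partial i (fun z => u z 0 a : R^o) in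
  \row_a \sum_i \sum_j invmx (g y) i j *
    (partial i (du a j) y - \sum_k christoffel g k i j y * du a k y
     + \sum_b \sum_c christoffel h a b c (u y) * du b i y * du c j y).

(* Linearization of the tension field at u in the direction v.  At a harmonic
   u the value does not depend on the coordinates: it is the coordinate
   expression of the Jacobi operator. *)
Definition tension_linearization {m n : nat} (g : 'rV[R]_m -> 'M[R]_m)
    (h : 'rV[R]_n -> 'M[R]_n) (u v : 'rV[R]_m -> 'rV[R]_n) (y : 'rV[R]_m) :
    'rV[R]_n :=
  derive1 (fun t : R => tension g h (fun z => u z + t *: v z) y) 0.

(* [holder_le k alpha K r u]: the C^(k,alpha) norm of u on K is at most r,
   for the norm given by the maximum of the sup norms of the partial
   derivatives of order <= k and of the alpha-Hoelder seminorms of those of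
   order k. *)
Definition holder_le {m : nat} {W : normedModType R} (k : nat) (alpha : R)
    (K : set 'rV[R]_m) (r : R) (u : 'rV[R]_m -> W) : Prop :=
  let der (s : seq 'I_m) := foldr partial u s in
  (forall s y, (size s <= k)%N -> K y -> `|der s y| <= r) /\
  (forall s y z, size s = k -> K y -> K z ->
     `|der s y - der s z| <= r * (`|y - z| `^ alpha)).

Definition holder_on {m : nat} {W : normedModType R} (k : nat) (alpha : R)
    (U : set 'rV[R]_m) (u : 'rV[R]_m -> W) : Prop :=
  Ck k U u /\
  forall y, U y -> exists r, exists2 B, nbhs y B & holder_le k alpha B r u.

End local_geometry.

Section riemannian.
Context {R : realType} {M : topologicalType} {m : nat}.
Variable A : manifold R M m.

(* A symmetric 2-tensor field g is given by its matrix [g x c] at the point x in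
   the chart c; only the values with [dom A c x] are meaningful. *)
Definition local_metric (g : M -> idx A -> 'M[R]_m) (c : idx A) :
  'rV[R]_m -> 'M[R]_m := fun y => g (point A c y) c.

Definition same_tensor (g g' : M -> idx A -> 'M[R]_m) : Prop :=
  forall x c, dom A c x -> g x c = g' x c.

(* f^* g = g *)
Definition preserves (f : M -> M) (g : M -> idx A -> 'M[R]_m) : Prop :=
  forall x c d, dom A c x -> dom A d (f x) ->
    g x c = Dmx f c d x *m g (f x) d *m (Dmx f c d x)^T.

Definition riemannian (g : M -> idx A -> 'M[R]_m) : Prop :=
  [/\ forall c, smooth_on (coord A c @` dom A c) (local_metric g c),
      preserves idfun g,
      forall x c, dom A c x -> (g x c)^T = g x c &
      forall x c (v : 'rV[R]_m), dom A c x -> v != 0 ->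
        0 < (v *m g x c *m v^T) 0 0].

Definition einstein (lambda : R) (g : M -> idx A -> 'M[R]_m) : Prop :=
  forall x c i j, dom A c x ->
    ricci (local_metric g c) i j (coord A c x) = lambda * g x c i j.

Definition geodesic_at (g : M -> idx A -> 'M[R]_m) (gam : R -> M) (t : R) :
    Prop :=
  forall c, dom A c (gam t) ->
    let u := coord A c \o gam in
    forall k, derive1n 2 u t 0 k + \sum_i \sum_j
      christoffel (local_metric g c) k i j (u t)
        * derive1 u t 0 i * derive1 u t 0 j = 0.

Definition unit_speed_at (g : M -> idx A -> 'M[R]_m) (gam : R -> M) (t : R) :
    Prop :=
  forall c, dom A c (gam t) ->
    let v := derive1 (coord A c \o gam) t in
    (v *m g (gam t) c *m v^T) 0 0 = 1.

End riemannian.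

(** * Lie group actions *)

Record is_lie_group {R : realType} {G : topologicalType} {l : nat}
    (AG : manifold R G l)
    (mul : G -> G -> G) (inv : G -> G) (e : G) : Prop := {
  lie_hausdorff : hausdorff_space G;
  lie_second_countable : @second_countable G;
  lie_mulA : associative mul;
  lie_mul1 : left_id e mul;
  lie_mulV : left_inverse e inv mul;
  lie_mul_smooth : smooth_map2 AG AG AG mul;
  lie_inv_smooth : smooth_map AG AG inv
}.

Section actions.
Context {R : realType} {G M : topologicalType} {l m : nat}.
Variables (AG : manifold R G l) (mul : G -> G -> G) (e : G) (A : manifold R M m).

Definition smooth_action (act : G -> M -> M) : Prop :=
  [/\ forall x, act e x = x,
      forall s t x, act (mul s t) x = act s (act t x) &
      smooth_map2 AG A A act].

(* The rows of this matrix span the tangent space at x of the orbit of x. *)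
Definition orbit_mx (act : G -> M -> M) (x : M) (a : idx AG) (c : idx A) :
  'M[R]_(l, m) := Dmx (act ^~ x) a c e.

(* The principal orbits, i.e. those of maximal dimension, have codimension 1. *)
Definition cohomogeneity_one (act : G -> M -> M) : Prop :=
  (forall x a c, dom AG a e -> dom A c x -> (\rank (orbit_mx act x a c) < m)%N)
  /\ exists x a c,
    [/\ dom AG a e, dom A c x & (\rank (orbit_mx act x a c)).+1 = m].

Definition normal_to_orbit_at (act : G -> M -> M) (g : M -> idx A -> 'M[R]_m)
    (gam : R -> M) (t : R) : Prop :=
  forall a c, dom AG a e -> dom A c (gam t) ->
    orbit_mx act (gam t) a c *m g (gam t) c
      *m (derive1 (coord A c \o gam) t)^T = 0.

Definition unit_normal_geodesic (act : G -> M -> M)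
    (g : M -> idx A -> 'M[R]_m) (len : R) (gam : R -> M) : Prop :=
  forall t, 0 <= t <= len ->
    [/\ geodesic_at g gam t, unit_speed_at g gam t
      & normal_to_orbit_at act g gam t].

End actions.

(** * Families of Einstein metrics *)

Section families.
Context {R : realType} {G M S : topologicalType} {l m s : nat}.
Variables (AG : manifold R G l) (e : G) (AM : manifold R M m) (AS : manifold R S s).

Record normalized_einstein_family (act : G -> M -> M) (lambda len : R)
    (gam : R -> M) (g : S -> M -> idx AM -> 'M[R]_m) : Prop := {
  family_riemannian : forall p, riemannian (g p);
  family_smooth : forall b c, smooth_on
    ((coord AS b @` dom AS b) `*` (coord AM c @` dom AM c))
    (fun z : 'rV[R]_s * 'rV[R]_m => g (point AS b z.1) (point AM c z.2) c);
  family_invariant : forall p t, preserves (act t) (g p);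
  family_einstein : forall p, einstein lambda (g p);
  family_normalized : forall p,
    unit_normal_geodesic AG e act (g p) len gam
}.

Definition metric_injective_near (g : S -> M -> idx AM -> 'M[R]_m) (p0 : S) :
    Prop :=
  exists2 U : set S, open U /\ U p0 &
    forall p q, U p -> U q -> same_tensor (g p) (g q) -> p = q.

(* The differential at p0 of p |-> g_p, with values in the symmetric 2-tensor
   fields on M, is injective. *)
Definition metric_immersed_at (g : S -> M -> idx AM -> 'M[R]_m) (p0 : S) :
    Prop :=
  forall b (v : 'rV[R]_s), dom AS b p0 -> v != 0 ->
    exists x c, dom AM c x /\
      'D_v (fun z => g (point AS b z) x c) (coord AS b p0) != 0.

End families.

(** * Harmonic maps and their Jacobi operators *)

Section harmonic.
Context {R : realType} {G M N : topologicalType} {l m n : nat}.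
Variables (AG : manifold R G l) (AM : manifold R M m) (AN : manifold R N n).
Variables (actM : G -> M -> M) (actN : G -> N -> N).
Implicit Types (f : M -> N) (h : N -> idx AN -> 'M[R]_n).
Implicit Types (g : M -> idx AM -> 'M[R]_m).

Definition harmonic g h f : Prop :=
  forall x c d, dom AM c x -> dom AN d (f x) ->
    tension (local_metric g c) (local_metric h d)
      (local_rep f c d) (coord AM c x) = 0.

Definition equivariant f : Prop := forall t x, f (actM t x) = actN t (f x).

(* H may be taken constant on t <= 0 and on t >= 1. *)
Definition equivariantly_homotopic f f' : Prop :=
  exists H : R -> M -> N,
    [/\ continuous (fun z : R * M => H z.1 z.2),
        forall t, equivariant (H t), H 0 = f & H 1 = f'].

Definition holder_map (k : nat) (alpha : R) f : Prop :=
  continuous f /\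
  forall (c : idx AM) (d : idx AN), holder_on k alpha (chart_dom f c d) (local_rep f c d).

(* Sections of f^*TN: [V x d] is the row vector of the components of the
   tangent vector V(x) at f x in the chart d, and 0 when d is not a chart
   around f x. *)
Definition section_along f (V : M -> idx AN -> 'rV[R]_n) : Prop :=
  (forall x d d', dom AN d (f x) -> dom AN d' (f x) ->
     V x d' = V x d *m Dmx idfun d d' (f x)) /\
  (forall x d, ~ dom AN d (f x) -> V x d = 0).

Definition equivariant_section f (V : M -> idx AN -> 'rV[R]_n) : Prop :=
  forall t x d d', dom AN d (f x) -> dom AN d' (actN t (f x)) ->
    V (actM t x) d' = V x d *m Dmx (actN t) d d' (f x).

Definition local_section (V : M -> idx AN -> 'rV[R]_n) (c : idx AM)
  (d : idx AN) : 'rV[R]_m -> 'rV[R]_n := fun y => V (point AM c y) d.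

Definition holder_section (k : nat) (alpha : R) f
    (V : M -> idx AN -> 'rV[R]_n) : Prop :=
  forall (c : idx AM) (d : idx AN), holder_on k alpha (chart_dom f c d) (local_section V c d).

(* The equivariant C^(k,alpha) sections along f that satisfy the linear
   constraints C. *)
Definition constrained_holder_space (k : nat) (alpha : R) f
    (C : set (M -> idx AN -> 'rV[R]_n)) : set (M -> idx AN -> 'rV[R]_n) :=
  [set V | [/\ section_along f V, equivariant_section f V,
               holder_section k alpha f V & C V]].

(* Finitely many coordinate pieces (c, d, K), K compact in the domain of
   [local_rep f c d], whose interiors cover M: they define the C^(k,alpha)
   norms of maps near f and of sections along f. *)
Definition coordinate_cover f (r : nat)
    (cov : 'I_r -> idx AM * idx AN * set 'rV[R]_m) : Prop :=
  (forall i, let: (c, d, K) := cov i in compact K /\ K `<=` chart_dom f c d) /\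
  (forall x : M, exists i, let: (c, d, K) := cov i in nbhs x (point AM c @` K)).

Definition section_holder_le (k : nat) (alpha : R) (r : nat)
    (cov : 'I_r -> idx AM * idx AN * set 'rV[R]_m) (B : R)
    (V : M -> idx AN -> 'rV[R]_n) : Prop :=
  forall i, let: (c, d, K) := cov i in
    holder_le k alpha K B (local_section V c d).

Definition holder_close (k : nat) (alpha : R) (r : nat)
    (cov : 'I_r -> idx AM * idx AN * set 'rV[R]_m) (eps : R) f f' : Prop :=
  forall i, let: (c, d, K) := cov i in
    [/\ K `<=` chart_dom f c d, K `<=` chart_dom f' c d
      & holder_le k alpha K eps (local_rep f c d - local_rep f' c d)].

(* Phi is a linear homeomorphism of the Banach space E onto the constrained
   equivariant C^(k,alpha) space along f. *)
Definition holder_trivialization (k : nat) (alpha : R) f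
    (C : set (M -> idx AN -> 'rV[R]_n)) (E : normedModType R)
    (Phi : E -> M -> idx AN -> 'rV[R]_n) : Prop :=
  [/\ forall a u v x d, Phi (a *: u + v) x d = a *: Phi u x d + Phi v x d,
      injective Phi,
      range Phi = constrained_holder_space k alpha f C &
      exists r (cov : 'I_r -> idx AM * idx AN * set 'rV[R]_m),
        coordinate_cover f cov /\
        exists2 B : R, 0 < B & forall u,
          section_holder_le k alpha cov (B * `|u|) (Phi u) /\
          forall b, section_holder_le k alpha cov b (Phi u) -> `|u| <= B * b].

(* The operator JF : E -> F is, through Phi and Psi, the linearization at f of
   the tension field of maps (M, g) -> (N, h). *)
Definition represents_jacobi g h f (E F : normedModType R)
    (Phi : E -> M -> idx AN -> 'rV[R]_n) (Psi : F -> M -> idx AN -> 'rV[R]_n)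
    (JF : E -> F) : Prop :=
  forall u x c d, dom AM c x -> dom AN d (f x) ->
    Psi (JF u) x d =
    tension_linearization (local_metric g c) (local_metric h d)
      (local_rep f c d) (local_section (Phi u) c d) (coord AM c x).

(* The maps of the probe class: equivariantly homotopic to f0, of class
   C^(k+2,alpha), and subject to the constraints adm. *)
Definition probe_class (k : nat) (alpha : R) (adm : set (M -> N)) f0 :
    set (M -> N) :=
  [set f | [/\ equivariant f, equivariantly_homotopic f0 f,
               holder_map k.+2 alpha f & adm f]].

End harmonic.

Section probes.
Context {R : realType} {G M N S : topologicalType} {l m n s : nat}.
Variables (AM : manifold R M m) (AN : manifold R N n) (AS : manifold R S s).
Variables (actM : G -> M -> M) (actN : G -> N -> N).
Variables (k : nat) (alpha : R).

(* f p is the only harmonic map for g p in the probe class of f0 = f p0 which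
   is C^(k+2,alpha)-close to f0, and it depends smoothly on p. *)
Record harmonic_family (p0 : S) (g : S -> M -> idx AM -> 'M[R]_m)
    (h : N -> idx AN -> 'M[R]_n) (adm : set (M -> N)) (f : S -> M -> N) :
    Prop := {
  harmonic_class : forall p, probe_class AM AN actM actN k alpha adm (f p0) (f p);
  harmonic_eq : forall p, harmonic (g p) h (f p);
  harmonic_smooth : smooth_map2 AS AM AN f;
  harmonic_unique :
    exists r (cov : 'I_r -> idx AM * idx AN * set 'rV[R]_m),
      coordinate_cover (f p0) cov /\
      exists2 eps : R, 0 < eps & forall p,
        holder_close k.+2 alpha cov eps (f p) (f p0) /\
        forall f', probe_class AM AN actM actN k alpha adm (f p0) f' ->
          harmonic (g p) h f' ->
          holder_close k.+2 alpha cov eps f' (f p0) -> f' = f p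
}.

Definition smooth_trivialization (f : S -> M -> N) (E : normedModType R)
    (Phi : S -> E -> M -> idx AN -> 'rV[R]_n) : Prop :=
  forall b x d, smooth_on
    [set z : 'rV[R]_s * E | (coord AS b @` (dom AS b `&`
                               [set p | dom AN d (f p x)])) z.1]
    (fun z => Phi (point AS b z.1) z.2 x d).

(* The operators J p and their inverses G p, read in the fixed spaces E and F
   through the trivializations Phi and Psi.  C2 and C0 are the linear
   constraints on the C^(k+2,alpha) and C^(k,alpha) sections along a map. *)
Record jacobi_package (g : S -> M -> idx AM -> 'M[R]_m)
    (h : N -> idx AN -> 'M[R]_n) (f : S -> M -> N)
    (C2 C0 : (M -> N) -> set (M -> idx AN -> 'rV[R]_n))
    (E F : normedModType R)
    (Phi : S -> E -> M -> idx AN -> 'rV[R]_n)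
    (Psi : S -> F -> M -> idx AN -> 'rV[R]_n)
    (Jop : S -> {linear E -> F}) (Gop : S -> {linear F -> E}) : Prop := {
  package_trivE : forall p,
    holder_trivialization AM actM actN k.+2 alpha (f p) (C2 (f p)) (Phi p);
  package_trivF : forall p,
    holder_trivialization AM actM actN k alpha (f p) (C0 (f p)) (Psi p);
  package_smoothE : smooth_trivialization f Phi;
  package_smoothF : smooth_trivialization f Psi;
  package_jacobi : forall p,
    represents_jacobi (g p) h (f p) (Phi p) (Psi p) (Jop p);
  package_Jcont : forall p, continuous (Jop p);
  package_Gcont : forall p, continuous (Gop p);
  package_JK : forall p, cancel (Jop p) (Gop p);
  package_GK : forall p, cancel (Gop p) (Jop p)
}.

End probes.

(* Main.v *)
From HB Require Import structures.
Require Import Defs.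
From mathcomp Require Import all_boot all_order all_algebra.
From mathcomp Require Import all_classical all_reals all_analysis.
From mathcomp Require Import lra.
Import Defs.
Import Order.TTheory GRing.Theory Num.Theory numFieldNormedType.Exports.
Local Open Scope classical_set_scope.
Local Open Scope ring_scope.

(** Since the parameter manifold is finite dimensional, compactness of the unit
    sphere makes a C^1 chart expression of the core package strictly
    differentiable, so an injective differential at [p0] gives a lower bound
    [k |x - y| <= |A x - A y|] in one pair of charts on a whole neighbourhood
    [U] of [p0].  This bound gives injectivity and continuity of the inverse on
    [U] and, since chart changes are locally Lipschitz, a bounded below
    differential in every pair of charts at every point of [U].  A bounded below
    linear map from a finite-dimensional space has a continuous left inverse, by
    Hahn-Banach applied to the coordinate functionals.  The same estimate, for a
    family of maps jointly injective to first order, shows that an immersed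
    family of metrics is locally injective. *)

Section auxiliary.
Set Implicit Arguments.
Unset Strict Implicit.

(** * First-order estimates and a mean value inequality *)

Section differentiation.
Context {R : realType} {V W : normedModType R}.

Lemma diff_approx (f : V -> W) (x : V) (e : R) :
  differentiable f x -> 0 < e ->
  \forall z \near x, `|f z - f x - 'd f x (z - x)| <= e * `|z - x|.
Proof.
move=> /diff_locally /eqaddoP dfx e0; rewrite (near_shift 0 x) subr0.
move: (dfx e e0); apply: filterS => z /=.
by rewrite addrK opprD addrA.
Qed.

Lemma diff_locally_lipschitz (f : V -> W) (x : V) : differentiable f x ->
  exists2 L : R, 0 < L & \forall z \near x, `|f z - f x| <= L * `|z - x|.
Proof.
move=> df; have [L L0 dfL] := linear_lipschitz (diff_continuous df).
exists (1 + L); first by rewrite addr_gt0.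
have := diff_approx df ltr01; apply: filterS => z fz.
rewrite mulrDl -[f z - f x](subrK ('d f x (z - x))).
by rewrite (le_trans (ler_normD _ _)) ?lerD.
Qed.

(** Along [x + t *: v] the increment of [f] is [t *: 'd f x v] up to an error [t * e]. Dividing by a
    small [t > 0] passes the bound to the differential up to [e], which is arbitrary. *)
Lemma diff_norm_ge (f : V -> W) (x : V) (c : R) : differentiable f x ->
  (\forall z \near x, c * `|z - x| <= `|f z - f x|) ->
  forall v, c * `|v| <= `|'d f x v|.
Proof.
move=> df fx v; apply/ler_addgt0Pr => e e0.
have [->|v0] := eqVneq v 0; first by rewrite normr0 mulr0 addr_ge0// ltW.
have nv0 : 0 < `|v| by rewrite normr_gt0.
have near_x : \forall z \near x, c * `|z - x| <= `|f z - f x| /\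
    `|f z - f x - 'd f x (z - x)| <= e / `|v| * `|z - x|.
  by apply: filterI => //; apply: diff_approx => //; rewrite divr_gt0.
have /nbhs_normP[d /= d0 dP] := near_x.
pose t := (d / 2) / `|v|.
have t0 : 0 < t by rewrite !divr_gt0.
have [] := dP (x + t *: v).
  rewrite /= opprD addNKr normrN normrZ gtr0_norm// /t divfK ?gt_eqF//.
  by rewrite gtr_pMr// invf_lt1// ltr1n.
rewrite /= [x + _ - x]addrC addKr linearZ/= normrZ gtr0_norm// => h1 h2.
have : `|f (x + t *: v) - f x| <= t * (e + `|'d f x v|).
  rewrite -[f _ - f x](subrK (t *: 'd f x v)) mulrDr.
  apply: (le_trans (ler_normD _ _)); rewrite lerD//.
    by rewrite (le_trans h2)// mulrCA divfK ?gt_eqF// mulrC.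
  by rewrite normrZ gtr0_norm.
by move/(le_trans h1); rewrite mulrCA ler_pM2l// addrC.
Qed.

End differentiation.

(** Continuous induction: the supremum [m] of the times up to 1 at which [|u t - u 0| <= C * t]
    belongs to that set, by the local bound at [m] on its left. If [m < 1], the same bound on its
    right produces a later time. *)
Lemma mean_value_inequality {R : realType} {W : normedModType R}
    (u : R -> W) (C : R) :
  (forall t : R, 0 <= t <= 1 ->
     \forall r \near t, `|u r - u t| <= C * `|r - t|) ->
  `|u 1 - u 0| <= C.
Proof.
move=> uC.
pose A := [set t | 0 <= t <= 1 /\ `|u t - u 0| <= C * t].
have A0 : A 0 by split; rewrite ?lexx ?ler01// subrr normr0 mulr0.
have ubA : ubound A 1 by move=> t [/andP[]].
have supA : has_sup A by split; [exists 0|exists 1].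
set m := sup A.
have m01 : 0 <= m <= 1.
  apply/andP; split; first by apply: (ub_le_sup _ A0); exists 1.
  by apply: ge_sup => //; exists 0.
have /nbhs_normP[d /= d0 dP] := uC m m01.
have Am : A m.
  split => //; have [t At mt] := sup_adherent d0 supA.
  have tm : t <= m by apply: (ub_le_sup _ At); exists 1.
  have := dP t; rewrite /= ger0_norm ?subr_ge0// ltrBlDl -ltrBlDr.
  move=> /(_ mt); rewrite distrC [`|t - m|]distrC ger0_norm ?subr_ge0// => mC.
  have [_ tC] := At.
  rewrite -(subrK (u t) (u m)) -addrA (le_trans (ler_normD _ _))//.
  by rewrite (le_trans (lerD mC tC))// -mulrDr subrK.
have [m1|] := eqVneq m 1; first by have [_] := Am; rewrite m1 mulr1.
move=> m1; have {m1}m1 : m < 1 by rewrite lt_neqAle m1; case/andP: m01.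
pose t := Num.min 1 (m + d / 2).
have mt : m < t by rewrite lt_min m1/= ltrDl divr_gt0.
have /andP[m0 _] := m01.
suff /(ub_le_sup (proj2 supA)) : A t by rewrite leNgt mt.
split; first by rewrite (le_trans m0 (ltW mt))/= ge_min lexx.
have := dP t; rewrite /= distrC gtr0_norm ?subr_gt0// ltrBlDl => tC.
have {}tC : `|u t - u m| <= C * (t - m).
  by apply: tC; rewrite gt_min ltrD2l gtr_pMr// invf_lt1 ?ltr1n ?orbT.
have [_ mC] := Am.
rewrite -(subrK (u m) (u t)) -addrA (le_trans (ler_normD _ _))//.
by rewrite (le_trans (lerD tC mC))// -mulrDr subrK.
Qed.

(** * Hahn-Banach extension and continuous left inverses *)

Lemma mx_entry_norm_le {R : realType} {m n : nat} (v : 'M[R]_(m, n)) i j :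
  `|v i j| <= `|v|.
Proof.
rewrite -[`|v|]/(mx_norm v) mx_normrE.
exact: (le_bigmax _ (fun ij : 'I_m * 'I_n => `|v ij.1 ij.2|) (i, j)).
Qed.

Lemma mx_norm_le {R : realType} {m n : nat} (v : 'M[R]_(m, n)) (c : R) :
  0 <= c -> (forall i j, `|v i j| <= c) -> `|v| <= c.
Proof.
move=> c0 vc; rewrite -[`|v|]/(mx_norm v) mx_normrE.
by apply/bigmax_leP; split.
Qed.

Section hahn_banach.
Context {R : realType} {V : normedModType R}.
Variable C : R.

(* Graphs of linear functionals of norm at most [C] on subspaces of [V]:
   single-valuedness follows from the bound. *)
Definition bounded_linear_graph (G : set (V * R)) : Prop :=
  [/\ G (0, 0),
      forall a x r y s, G (x, r) -> G (y, s) -> G (a *: x + y, a * r + s) &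
      forall x r, G (x, r) -> r <= C * `|x|].

Lemma bounded_linear_graph_scale G a x r :
  bounded_linear_graph G -> G (x, r) -> G (a *: x, a * r).
Proof. by case=> G0 GD _ Gx; have := GD a _ _ _ _ Gx G0; rewrite !addr0. Qed.

Lemma bounded_linear_graph_norm G x r :
  bounded_linear_graph G -> G (x, r) -> `|r| <= C * `|x|.
Proof.
move=> bG Gx; have [_ _ GC] := bG; rewrite ler_norml (GC _ _ Gx) andbT.
have := GC _ _ (bounded_linear_graph_scale (-1) bG Gx).
by rewrite scaleN1r mulN1r normrN lerNl.
Qed.

Lemma bounded_linear_graph_fun G x r s :
  bounded_linear_graph G -> G (x, r) -> G (x, s) -> r = s.
Proof.
move=> bG Gr Gs; have [_ GD _] := bG; apply/eqP; rewrite -subr_eq0 -normr_le0.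
have := bounded_linear_graph_norm bG (GD (-1) _ _ _ _ Gs Gr).
by rewrite scaleN1r addNr normr0 mulr0 mulN1r addrC.
Qed.

(** The value [a] at [x0] must lie above every [r - C * |x - x0|] and below every
    [C * |y + x0| - s], for [(x, r)] and [(y, s)] in [G]. The triangle inequality separates these
    two families, and [a] is the supremum of the first. *)
Lemma bounded_linear_graph_extend G x0 : 0 <= C -> bounded_linear_graph G ->
  exists a, bounded_linear_graph
    [set z | exists t x r, G (x, r) /\ z = (x + t *: x0, r + t * a)].
Proof.
move=> C0 bG; have [G0 GD GC] := bG.
pose A := [set b | exists x r, G (x, r) /\ b = r - C * `|x - x0|].
have AC y s : G (y, s) -> ubound A (C * `|y + x0| - s).
  move=> Gy b [x [r [Gx ->]]].
  rewrite lerBrDl addrA lerBlDr -mulrDr addrC.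
  have := GC _ _ (GD 1 _ _ _ _ Gx Gy).
  rewrite scale1r mul1r => /le_trans; apply.
  rewrite ler_wpM2l//; apply: le_trans (ler_normD _ _).
  by rewrite [y + x0]addrC addrA -[x0 + y + x]addrA [x0 + _]addrC addrK addrC.
have supA : has_sup A.
  split; first by exists (0 - C * `|0 - x0|), 0, 0.
  by exists (C * `|0 + x0| - 0); exact: AC.
exists (sup A); split.
- by exists 0, 0, 0; rewrite scale0r mul0r !add0r; split; [exact: G0|].
- move=> b _ _ _ _ [t [x [r [Gx [-> ->]]]]] [t' [y [s [Gy [-> ->]]]]].
  exists (b * t + t'), (b *: x + y), (b * r + s); split; first exact: GD.
  congr pair; first by rewrite scalerDr scalerA scalerDl addrACA.
  by rewrite mulrDr mulrA mulrDl addrACA.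
move=> _ _ [t [x [r [Gx [-> ->]]]]].
(* After division by [|t|], a negative [t] calls for the lower constraints on [sup A] and a positive
   [t] for the upper ones. *)
have [t0|t0|->] := ltgtP t 0; last by rewrite scale0r mul0r !addr0 GC.
- have : A ((- t^-1) * r - C * `|(- t^-1) *: x - x0|).
    exists (- t^-1 *: x), (- t^-1 * r); split => //.
    exact: bounded_linear_graph_scale Gx.
  move=> /(ub_le_sup (proj2 supA)); rewrite -(ler_nM2l t0) mulrBr mulrA mulrN.
  rewrite mulfV ?lt_eqF// mulN1r addrC lerBrDl => /le_trans; apply.
  have nt0 : 0 < - t by rewrite oppr_gt0.
  rewrite -mulNr mulrCA -[X in _ * (X * _)](gtr0_norm nt0) -normrZ.
  by rewrite scalerBr scalerA mulrNN mulfV ?lt_eqF// scale1r scaleNr opprK.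
- have := AC _ _ (bounded_linear_graph_scale t^-1 bG Gx).
  move=> /(sup_le_ub (proj1 supA)); rewrite -(ler_pM2l t0) mulrBr.
  rewrite [t * (t^-1 * r)]mulrA mulfV ?gt_eqF// mul1r lerBrDl.
  move=> /le_trans; apply.
  rewrite mulrCA -[X in _ * (X * _)](gtr0_norm t0) -normrZ scalerDr scalerA.
  by rewrite mulfV ?gt_eqF// scale1r.
Qed.

(** Zorn's lemma is applied to the sets [H] that become graphs after adjoining [G], so that the
    empty chain is covered too. A maximal graph is defined everywhere, by the one-dimensional
    extension. *)
Lemma hahn_banach_graph G : 0 <= C -> bounded_linear_graph G ->
  exists u : {linear V -> R^o},
    (forall x r, G (x, r) -> u x = r) /\ forall x, `|u x| <= C * `|x|.
Proof.
move=> C0 bG.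
have [F totF chainF|H [bH maxH]] :=
    @Zorn_bigcup (V * R) [set H | bounded_linear_graph (G `|` H)].
  (* Linearity involves two points at a time, and by the chain condition both already lie in a
     single graph. *)
  have two z w : (G `|` \bigcup_(X in F) X) z -> (G `|` \bigcup_(X in F) X) w ->
    exists2 X, bounded_linear_graph (G `|` X) /\ X `<=` \bigcup_(X in F) X &
      (G `|` X) z /\ (G `|` X) w.
    have inF X : F X ->
        bounded_linear_graph (G `|` X) /\ X `<=` \bigcup_(X in F) X.
      by move=> FX; split; [exact: totF|exact: bigcup_sup].
    move=> [Gz|[X FX Xz]] [Gw|[Y FY Yw]].
    - by exists set0; [split; [rewrite setU0|exact: sub0set]|split; left].
    - by exists Y; [exact: inF|split; [left|right]].
    - by exists X; [exact: inF|split; [right|left]].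
    - have [XY|YX] := chainF _ _ FX FY.
        by exists Y; [exact: inF|split; right => //; exact: XY].
      by exists X; [exact: inF|split; right => //; exact: YX].
  have [G0 _ _] := bG; split; first by left.
    move=> a x r y t /two/[apply] -[X [bX XF] [Xx Xy]].
    have [_ GD _] := bX; have [|/XF] := GD a _ _ _ _ Xx Xy; by [left|right].
  by move=> x r /[dup] /two/[apply] -[X [[_ _ GC] _] [Xx _]]; exact: GC.
have full x : exists r, (G `|` H) (x, r).
  have [a] := bounded_linear_graph_extend x C0 bH; set H' := [set _ | _] => bH'.
  have GHH' : G `|` H `<=` H'.
    move=> [y r] Gy; exists 0, y, r; split => //.
    by rewrite scale0r mul0r !addr0.
  (* If [x] had no value, the extension [H'] along [x] would contain [(x, a)] and be strictly larger
     than [H]. *)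
  apply: contrapT => /forallNP nx; apply: (maxH H').
    split; first by apply: subset_trans GHH'; exact: subsetUr.
    move=> H'H; apply: (nx a); right; apply: H'H; exists 1, 0, 0.
    by split; [case: bH|rewrite scale1r mul1r !add0r].
  by rewrite /= setUidr//; apply: subset_trans GHH'; exact: subsetUl.
have [u uP] := choice full.
have lu : linear (u : V -> R^o).
  move=> a v w; apply: (bounded_linear_graph_fun bH (uP _)).
  by have [_ GD _] := bH; exact: GD.
pose ul : {linear V -> R^o} :=
  HB.pack (u : V -> R^o) (GRing.isLinear.Build _ _ _ _ (u : V -> R^o) lu).
exists ul; split => [x r Gx|x]; last exact: bounded_linear_graph_norm bH (uP x).
by apply: (bounded_linear_graph_fun bH (uP _)); left.
Qed.

End hahn_banach.

(** The lower bound makes each [T v |-> v 0 i] a functional of norm at most [c^-1] on the range of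
    [T]. Its extensions to [W] are the entries of [L]. *)
Lemma linear_left_inverse {R : realType} {s : nat} {W : normedModType R}
    (T : {linear 'rV[R]_s -> W}) (c : R) :
  0 < c -> (forall v, c * `|v| <= `|T v|) ->
  exists L : {linear W -> 'rV[R]_s}, continuous L /\ forall v, L (T v) = v.
Proof.
move=> c0 Tc.
have c'0 : 0 <= c^-1 by rewrite invr_ge0 ltW.
have bG i : bounded_linear_graph c^-1 [set z | exists v, z = (T v, v 0 i : R)].
  split.
  - by exists 0; rewrite linear0 mxE.
  - move=> a _ _ _ _ [v [-> ->]] [w [-> ->]]; exists (a *: v + w).
    by rewrite linearP !mxE.
  - move=> _ _ [v [-> ->]]; rewrite ler_pdivlMl//.
    apply: le_trans (Tc v); rewrite ler_pM2l//.
    exact: le_trans (ler_norm _) (mx_entry_norm_le _ _ _).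
have /choice[u uP] := fun i => hahn_banach_graph c'0 (bG i).
pose L (w : W) : 'rV[R]_s := \row_i u i w.
have lL : linear L by move=> a v w; apply/rowP => i; rewrite !mxE linearP.
pose Llin : {linear W -> 'rV[R]_s} :=
  HB.pack L (GRing.isLinear.Build _ _ _ _ L lL).
exists Llin; split.
  apply: bounded_linear_continuous; apply/linear_boundedP.
  near=> r => w; apply: (@le_trans _ _ (c^-1 * `|w|)).
    apply: mx_norm_le => [|i j]; first by rewrite mulr_ge0.
    by rewrite mxE; have [_] := uP j; apply.
  by rewrite ler_wpM2r//; near: r; exact: nbhs_pinfty_ge.
move=> v; apply/rowP => i; rewrite mxE; have [+ _] := uP i; apply.
by exists v.
Unshelve. all: by end_near. Qed.

(** * Strict differentiability and lower bounds in finite dimension *)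

Lemma smooth_on_subset {R : realType} {V W : normedModType R} (U U' : set V)
  (f : V -> W) : U' `<=` U -> smooth_on U f -> smooth_on U' f.
Proof.
move=> UU' sf n; move: (sf n).
elim: n V W U U' UU' f {sf} => [|n IHn] V W U U' UU' f.
  by move=> /= cf x /UU'; exact: cf.
move=> /= [df sf]; split=> [x /UU'|]; first exact: df.
by apply: IHn sf => -[x v] [/= U'x _]; split => //; exact: UU'.
Qed.

Lemma sphere_compact {R : realType} {s : nat} :
  compact [set v : 'rV[R]_s | `|v| = 1].
Proof.
apply: bounded_closed_compact.
  by exists 1; split => // M M1 v /= ->; exact: ltW.
rewrite (_ : [set _ | _] = (fun v : 'rV[R]_s => `|v|) @^-1` [set 1])//.
by apply: closed_comp => [v _|]; [exact: norm_continuous|exact: closed_eq].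
Qed.

Lemma scale_unit {R : realType} {V : normedModType R} (v : V) : v != 0 ->
  exists2 w : V, `|w| = 1 & v = `|v| *: w.
Proof.
move=> v0; have nv0 : `|v| != 0 by rewrite normr_eq0.
exists (`|v|^-1 *: v); last by rewrite scalerA mulfV// scale1r.
by rewrite normrZ normfV normr_id mulVf.
Qed.

Lemma linear_dist_le {R : realType} {V W : normedModType R}
    (T T' : {linear V -> W}) (e : R) :
  (forall w, `|w| = 1 -> `|T w - T' w| <= e) ->
  forall v, `|T v - T' v| <= e * `|v|.
Proof.
move=> TT' v; have [->|/scale_unit[w w1 ->]] := eqVneq v 0.
  by rewrite linear0 linear0 subrr !normr0 mulr0.
rewrite linearZ_LR linearZ_LR -scalerBr !normrZ w1 mulr1 normr_id mulrC.
by rewrite ler_wpM2r//; exact: TT'.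
Qed.

(** The mean value inequality is applied to the deviation of [f] from the one linear map [T] along
    the segment from [z] to [y]. *)
Lemma linear_approx_segment {R : realType} {V W : normedModType R}
    (f : V -> W) (T : {linear V -> W}) (y z : V) (e : R) :
  (forall t, 0 <= t <= 1 -> \forall w \near z + t *: (y - z),
     `|f w - f (z + t *: (y - z)) - T (w - (z + t *: (y - z)))|
       <= e * `|w - (z + t *: (y - z))|) ->
  `|f y - f z - T (y - z)| <= e * `|y - z|.
Proof.
move=> fT; pose w (t : R) := z + t *: (y - z).
pose u t := f (w t) - T (t *: (y - z)).
have -> : f y - f z - T (y - z) = u 1 - u 0.
  rewrite /u /w scale1r scale0r linear0 subr0 addr0 [z + _]addrC subrK.
  by rewrite addrAC.
apply: mean_value_inequality => t /fT fw.
have wt : w r @[r --> t] --> w t.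
  by apply: cvgD; [exact: cvg_cst|apply: cvgZr_tmp; exact: cvg_id].
have {}fw := wt _ fw.
near=> r.
have : `|f (w r) - f (w t) - T (w r - w t)| <= e * `|w r - w t|.
  by near: r; exact: fw.
have -> : w r - w t = (r - t) *: (y - z).
  by rewrite /w scalerBl opprD addrACA subrr add0r.
rewrite normrZ scalerBl linearB -[e * _ * _]mulrA [`|y - z| * _]mulrC.
by rewrite /u !opprB addrACA [_ - T _ + _]addrACA [- f _ + _]addrC.
Unshelve. all: by end_near. Qed.

Section strict_differentiability.
Context {R : realType} {s : nat} {W : normedModType R}.
Implicit Types (U : set 'rV[R]_s) (f : 'rV[R]_s -> W).

(** [Ck 1] only gives joint continuity of [(y, v) |-> 'd f y v]. Compactness of the unit sphere
    turns it into continuity of the differential in operator norm. *)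
Lemma diff_uniformly_close U f x (e : R) : open U -> U x -> Ck 1 U f -> 0 < e ->
  \forall y \near x, U y /\ forall v, `|'d f y v - 'd f x v| <= e * `|v|.
Proof.
move=> oU Ux [df cdf] e0; apply: filterI; first exact: open_nbhs_nbhs.
have cover : near_covering [set v : 'rV[R]_s | `|v| = 1].
  by apply/compact_near_coveringP; exact: sphere_compact.
have : \forall y \near x,
    [set v : 'rV[R]_s | `|v| = 1] `<=` (fun v => `|'d f y v - 'd f x v| <= e).
  apply: (cover _ (nbhs x) (fun y v => `|'d f y v - 'd f x v| <= e)) => v _.
  have e2 : 0 < e / 2 by rewrite divr_gt0.
  have cv : 'd f x v' @[v' --> v] --> 'd f x v.
    by apply: diff_continuous; exact: df.
  have /cvgrPdist_le/(_ _ e2) {}cv := cv.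
  have /cvgrPdist_le/(_ _ e2) := cdf (x, v) (conj Ux I).
  move=> [[P Q] /= [Px Qv] PQ].
  exists (Q `&` (fun v' => `|'d f x v - 'd f x v'| <= e / 2), P) => /=.
    by split => //; exact: filterI.
  move=> [v' y] /= [[Qv' xv'] Py]; have /= yv' := PQ (y, v') (conj Py Qv').
  have -> : 'd f y v' - 'd f x v' =
      'd f y v' - 'd f x v + ('d f x v - 'd f x v').
    by rewrite addrA subrK.
  apply: (le_trans (ler_normD _ _)); rewrite (splitr e).
  by apply: lerD; [rewrite distrC; exact: yv'|exact: xv'].
apply: filterS => y xy v.
by apply: linear_dist_le => w w1; exact: xy.
Qed.

(** One half of [e] pays for differentiability at each point of the segment, the other for replacing
    the differential there by the one at [x]. *)
Lemma strict_differentiability U f x (e : R) :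
  open U -> U x -> Ck 1 U f -> 0 < e ->
  \forall y \near x & z \near x,
    `|f y - f z - 'd f x (y - z)| <= e * `|y - z|.
Proof.
move=> oU Ux Uf e0; have [df _] := Uf.
have e2 : 0 < e / 2 by rewrite divr_gt0.
have /nbhs_normP[d /= d0 dP] := diff_uniformly_close oU Ux Uf e2.
suff close (y z : 'rV[R]_s) : `|x - y| < d -> `|x - z| < d ->
    `|f y - f z - 'd f x (y - z)| <= e * `|y - z|.
  have xd : \forall y \near x, `|x - y| < d by apply/nbhs_normP; exists d.
  exists ([set y | `|x - y| < d], [set z | `|x - z| < d]) => // -[y z].
  by move=> [/= xy xz]; exact: close.
move=> xy xz; apply: linear_approx_segment => t /andP[t0 t1].
(* Balls are convex, so the whole segment stays where the differential is close to ['d f x]. *)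
have xw : `|x - (z + t *: (y - z))| < d.
  have -> : x - (z + t *: (y - z)) = t *: (x - y) + (1 - t) *: (x - z).
    rewrite scalerBl scale1r addrCA -scalerBr opprB [x - y + _]addrC addrA.
    by rewrite subrK opprD addrA -scalerN opprB.
  apply: (le_lt_trans (ler_normD _ _)); rewrite !normrZ (ger0_norm t0).
  rewrite ger0_norm ?subr_ge0//.
  pose r := Num.max `|x - y| `|x - z|.
  apply: (@le_lt_trans _ _ (t * r + (1 - t) * r)).
    by rewrite lerD// ler_wpM2l ?subr_ge0// le_max lexx ?orbT.
  by rewrite -mulrDl subrKC mul1r gt_max xy xz.
move: (z + _) xw => w xw; have [Uw dw] := dP _ xw.
have := diff_approx (df _ Uw) e2; apply: filterS => v fv.
have -> : f v - f w - 'd f x (v - w) =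
    (f v - f w - 'd f w (v - w)) + ('d f w (v - w) - 'd f x (v - w)).
  by rewrite addrA subrK.
apply: (le_trans (ler_normD _ _)); apply: (le_trans (lerD fv (dw _))).
by rewrite -mulrDl -splitr.
Qed.

End strict_differentiability.

(** Each unit direction [v] has an index [i] with ['d (f i) x v] nonzero, and strict
    differentiability makes this [i] serve all nearby directions. Compactness of the sphere yields
    one constant and one neighbourhood, although [i] depends on the direction. *)
Lemma immersed_family_lower_bound {R : realType} {s : nat} {W : normedModType R}
    {I : Type} (U : set 'rV[R]_s) (f : I -> 'rV[R]_s -> W) (x : 'rV[R]_s) :
  open U -> U x -> (forall i, Ck 1 U (f i)) ->
  (forall v, v != 0 -> exists i, 'd (f i) x v != 0) ->
  exists2 c : R, 0 < c & \forall y \near x & z \near x,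
    y != z -> exists i, c * `|y - z| <= `|f i y - f i z|.
Proof.
move=> oU Ux Uf df0.
(* The parameter is [(c, (y, z))], with [c] tending to 0 from the right and [y], [z] to [x]. The
   near-covering property then makes all three uniform in the direction [v]. *)
pose P (p : R * ('rV[R]_s * 'rV[R]_s)) (v : 'rV[R]_s) :=
  forall t, p.2.1 - p.2.2 = t *: v ->
    exists i, p.1 * `|t| <= `|f i p.2.1 - f i p.2.2|.
have cover : near_covering [set v : 'rV[R]_s | `|v| = 1].
  by apply/compact_near_coveringP; exact: sphere_compact.
have : \forall p \near filter_prod (0 : R)^'+ (filter_prod (nbhs x) (nbhs x)),
    [set v : 'rV[R]_s | `|v| = 1] `<=` P p.
  apply: (cover _ _ P) => v /= v1.
  have [|i dv0] := df0 v; first by rewrite -normr_eq0 v1 oner_eq0.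
  have : exists T : {linear 'rV[R]_s -> W}, continuous T /\ T = 'd (f i) x.
    exists ('d (f i) x); split => //.
    by apply: diff_continuous; have [+ _] := Uf i; apply.
  move=> [T [cT TE]]; rewrite -TE in dv0.
  have a0 : 0 < `|T v| by rewrite normr_gt0.
  set a := `|T v| in a0.
  (* For [w] near [v], [|T w| >= 3a/4] and [|w| <= 2]. The error [a/8 * |w|] is then at most [a/4],
     which leaves [a/2 >= c]. *)
  have a8 : 0 < a / 8 by rewrite divr_gt0.
  have a4 : 0 < a / 4 by rewrite divr_gt0.
  have strict := strict_differentiability oU Ux (Uf i) a8.
  rewrite -TE in strict.
  have /cvgrPdist_le/(_ _ a4) Tv : T w @[w --> v] --> T v by exact: cT.
  have /cvgrPdist_le/(_ _ ltr01) vv : w @[w --> v] --> v by exact: cvg_id.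
  pose close : set ('rV[R]_s * 'rV[R]_s) := fun p =>
    `|f i p.1 - f i p.2 - T (p.1 - p.2)| <= a / 8 * `|p.1 - p.2|.
  exists ([set w | `|T v - T w| <= a / 4 /\ `|v - w| <= 1],
    [set p | p.1 <= a / 2 /\ close p.2]) => /=.
    split; first exact: filterI.
    exists ([set c | c <= a / 2], close) => //=.
    by split => //; apply: nbhs_right_le; rewrite divr_gt0.
  move=> [w [c [y z]]] /= [[Tw vw] [ca fyz]] t /= yzE; exists i.
  rewrite /close /= yzE linearZ_LR normrZ in fyz.
  have w2 : `|w| <= 2.
    rewrite -(subrK v w) (le_trans (ler_normD _ _))// v1 distrC.
    by rewrite -[leRHS]/(1 + 1) lerD.
  have Tw' : a - a / 4 <= `|T w|.
    rewrite lerBlDr -lerBlDl; apply: le_trans Tw.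
    exact: lerB_dist.
  have fT : `|t *: T w| - `|f i y - f i z - t *: T w| <= `|f i y - f i z|.
    by rewrite distrC (le_trans (lerB_dist _ _))// opprB addrC subrK.
  apply: le_trans fT; rewrite normrZ.
  have h1 : `|t| * (a - a / 4) <= `|t| * `|T w| by rewrite ler_wpM2l.
  have h2 : a / 8 * (`|t| * `|w|) <= a / 8 * (`|t| * 2).
    by rewrite ler_wpM2l ?(ltW a8)// ler_wpM2l.
  have h3 : c * `|t| <= a / 2 * `|t| by rewrite ler_wpM2r.
  lra.
move=> [[A B] [/= A0 [[Y Z] /= [Yx Zx] YZB]] ABP].
have [c [Ac c0]] := filter_ex (filterI A0 (nbhs_right_gt 0)).
exists c => //.
exists (Y, Z) => // -[y z] [/= Yy Zz] yz.
have [|w w1 yzE] := @scale_unit _ _ (y - z); first by rewrite subr_eq0.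
have /= [i] := ABP (c, (y, z)) (conj Ac (YZB (y, z) (conj Yy Zz))) w w1 _ yzE.
by rewrite normr_id; exists i.
Qed.

(** * Passing estimates through charts *)

Section charts.
Context {R : realType} {T : topologicalType} {V : normedModType R} {O : set T}.
Variable A : atlas V O.

Lemma chart_image_open (c : idx A) (D : set T) :
  open D -> D `<=` dom A c -> open (coord A c @` D).
Proof.
move=> oD Dc; rewrite openE => _ [x Dx <-].
have imx : (coord A c @` dom A c) (coord A c x) by exists x => //; exact: Dc.
have pc := point_continuous imx.
have D' : nbhs (point A c (coord A c x)) D.
  by rewrite coordK; [exact: open_nbhs_nbhs|exact: Dc].
have : \forall y \near coord A c x, (coord A c @` dom A c) y /\ D (point A c y).
  apply: filterI; last exact: pc.
  by apply: open_nbhs_nbhs; split => //; exact: img_open.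
apply: filterS => _ [[q cq <-]]; rewrite coordK// => Dq; exists q.
Qed.

Lemma near_chart (c : idx A) (x : T) (P : T -> Prop) : dom A c x ->
  (\forall q \near x, P q) ->
  \forall y \near coord A c x,
    [/\ dom A c (point A c y), coord A c (point A c y) = y & P (point A c y)].
Proof.
move=> cx /(filterI (open_nbhs_nbhs (conj (dom_open c) cx))) Px.
have pE := coordK cx.
have imx : (coord A c @` dom A c) (coord A c x) by exists x.
have : \forall y \near coord A c x, (coord A c @` dom A c) y /\
   (dom A c (point A c y) /\ P (point A c y)).
  apply: filterI; first by apply: open_nbhs_nbhs; split => //; exact: img_open.
  have pc : point A c y @[y --> coord A c x] --> x.
    by rewrite -[X in _ --> X]pE; exact: point_continuous.
  exact: pc _ Px.
by apply: filterS => _ [[q cq <-]]; rewrite coordK// => -[].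
Qed.

(** The transition map is differentiable at the coordinate of [x]. One endpoint stays fixed at [x],
    which suffices for bounding a differential at [x] from below. *)
Lemma chart_change_lipschitz (c d : idx A) (x : T) : dom A c x -> dom A d x ->
  exists2 L : R, 0 < L & \forall q \near x,
    `|coord A d q - coord A d x| <= L * `|coord A c q - coord A c x|.
Proof.
move=> cx dx.
have [L L0 tL] : exists2 L : R, 0 < L & \forall y \near coord A c x,
    `|coord A d (point A c y) - coord A d (point A c (coord A c x))|
      <= L * `|y - coord A c x|.
  apply: (@diff_locally_lipschitz _ _ _ (coord A d \o point A c)).
  by have [+ _] := transition_smooth c d 1; apply; exists x.
exists L => //; rewrite coordK// in tL.
have {}tL := coord_continuous cx tL.
have nx : \forall q \near x, dom A c q.
  by apply: open_nbhs_nbhs; split => //; exact: dom_open.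
near=> q; have cq : dom A c q by near: q.
by rewrite -[q in coord A d q](coordK cq); near: q; exact: tL.
Unshelve. all: by end_near. Qed.

End charts.

(** * Local injectivity of immersed families of metrics *)

(** This freezes the point of [M] in a jointly smooth family of metrics. By the chain rule the slice
    has differential [v |-> 'd f (x, b) (v, 0)], which inherits joint continuity. *)
Lemma Ck1_slice {R : realType} {V V' W : normedModType R} (U : set V)
    (U' : set V') (f : V * V' -> W) (b : V') :
  open U -> U' b -> Ck 1 (U `*` U') f -> Ck 1 U (fun x => f (x, b)).
Proof.
move=> oU U'b [df cdf].
have dslice x : U x -> differentiable (fun x => f (x, b)) x /\
    forall v, 'd (fun x => f (x, b)) x v = 'd f (x, b) (v, 0).
  move=> Ux.
  have di : differentiable (fun x : V => (x, b)) x by [].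
  have dfx : differentiable f ((fun x : V => (x, b)) x) by apply: df.
  split; first exact: (differentiable_comp di dfx).
  move=> v; rewrite (_ : (fun x => f (x, b)) = f \o (fun x => (x, b)))//.
  rewrite diff_comp//= diff_pair//=.
  by rewrite diff_val diff_cst.
split=> [x /dslice[]//|] [x v] [/= Ux _].
have cemb :
    {for (x, v), continuous (fun z : V * V => ((z.1, b), (z.2, 0 : V')))}.
  have c1 : (z.1 : V) @[z --> (x, v)] --> x by exact: cvg_fst.
  have c2 : (z.2 : V) @[z --> (x, v)] --> v by exact: cvg_snd.
  have d1 : ((z.1, b) : V * V') @[z --> (x, v)] --> (x, b).
    exact: cvg_pair c1 (cvg_cst b).
  have d2 : ((z.2, 0) : V * V') @[z --> (x, v)] --> (v, 0 : V').
    exact: cvg_pair c2 (cvg_cst (0 : V')).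
  exact: cvg_pair d1 d2.
have cx : {for (x, v), continuous (fun z : V * V => 'd f (z.1, b) (z.2, 0))}.
  exact: continuous_comp cemb (cdf ((x, b), (v, 0)) (conj (conj Ux U'b) I)).
have [_ dxv] := dslice x Ux.
rewrite /prop_for /continuous_at /= dxv.
apply: cvg_trans cx; apply: near_eq_cvg.
have nU : \forall z \near (x, v), U z.1.
  by apply: (cvg_fst (F := nbhs x) (G := nbhs v)); apply: open_nbhs_nbhs.
near=> z; have Uz : U z.1 by near: z.
by have [_ ->] := dslice _ Uz.
Unshelve. all: by end_near. Qed.

(** Evaluating the metric at a point in a chart gives a family of matrix-valued maps of the
    parameter, and immersion says that their differentials have no common kernel. *)
Lemma immersed_metric_injective_near {R : realType} {M S : topologicalType}
    {m s : nat} (AM : manifold R M m) (AS : manifold R S s)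
    (g : S -> M -> idx AM -> 'M[R]_m) (p0 : S) :
  (forall b c, smooth_on
    ((coord AS b @` dom AS b) `*` (coord AM c @` dom AM c))
    (fun z : 'rV[R]_s * 'rV[R]_m => g (point AS b z.1) (point AM c z.2) c)) ->
  metric_immersed_at AS g p0 -> metric_injective_near g p0.
Proof.
move=> gsmooth imm; have [b bp0] := dom_cover AS I (x := p0).
(* Only charts around the point are indexed, since a metric is meaningful, and compared by
   [same_tensor], only there. *)
pose I := {i : M * idx AM | dom AM i.2 i.1}.
pose f (i : I) (y : 'rV[R]_s) := g (point AS b y) (sval i).1 (sval i).2.
have fC1 i : Ck 1 (coord AS b @` dom AS b) (f i).
  case: i => -[x c] /= cx.
  have xc : (coord AM c @` dom AM c) (coord AM c x) by exists x.
  have := Ck1_slice (img_open b) xc (gsmooth b c 1).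
  by rewrite /f /= coordK.
have imp0 : (coord AS b @` dom AS b) (coord AS b p0) by exists p0.
have [|c c0 fc] := immersed_family_lower_bound (img_open b) imp0 fC1.
  move=> v v0; have [x [c [cx dv0]]] := imm b v bp0 v0.
  exists (exist _ (x, c) cx); rewrite -deriveE//.
  by have [+ _] := fC1 (exist _ (x, c) cx); apply.
have [[Y Z] [/= Yp Zp] YZ] := fc.
have : \forall p \near p0, dom AS b p /\ (Y `&` Z) (coord AS b p).
  apply: filterI; first by apply: open_nbhs_nbhs; split => //; exact: dom_open.
  exact: (coord_continuous bp0 (filterI Yp Zp)).
rewrite -nbhs_nearE nbhsE => -[U [oU Up0] UYZ]; exists U => // p q Up Uq gpq.
have [bp [Yp' _]] := UYZ _ Up; have [bq [_ Zq']] := UYZ _ Uq.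
have [pq|/eqP npq] := eqVneq (coord AS b p) (coord AS b q).
  by rewrite -(coordK bp) pq coordK.
(* Distinct coordinates would give an index at which a positive multiple of their distance is
   bounded by 0. *)
have /= := YZ (_, _) (conj Yp' Zq').
move=> /(_ _)[|[[x c'] /= cx]]; first by apply/eqP.
rewrite /f /= !coordK// (gpq x c' cx) subrr normr0 pmulr_rle0//.
by rewrite normr_le0 subr_eq0 => /eqP.
Qed.

(** * Immersions of a finite-dimensional manifold into a Banach manifold *)

Section charts.
Context {R : realType} {S X : topologicalType} {s : nat} {B : normedModType R}
  {O : set X}.
Variables (AS : manifold R S s) (AX : atlas B O) (A : S -> X).

Lemma smooth_map_differentiable c d x : smooth_map AS AX A ->
  dom AS c x -> dom AX d (A x) ->
  differentiable (local_rep A c d) (coord AS c x).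
Proof. by move=> [_ sA] cx dx; have [+ _] := sA c d 1; apply; exists x. Qed.

Lemma immersion_lower_bound c d p : smooth_map AS AX A ->
  injective_differential AS AX A p -> dom AS c p -> dom AX d (A p) ->
  exists2 k : R, 0 < k & exists2 U : set S, open U /\ U p &
    forall x y, U x -> U y -> [/\ dom AS c x, dom AX d (A x) &
      k * `|coord AS c x - coord AS c y|
        <= `|coord AX d (A x) - coord AX d (A y)|].
Proof.
move=> [cA sA] injA cp dp.
have opre : open (dom AS c `&` A @^-1` dom AX d).
  apply: openI; first exact: dom_open.
  by apply: open_comp => [x _|]; [exact: cA|exact: dom_open].
have oU : open (chart_dom A c d) by apply: chart_image_open => // x [].
have Up : chart_dom A c d (coord AS c p) by exists p.
have [|k k0 kA] := immersed_family_lower_bound (I := unit)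
    (f := fun=> local_rep A c d) oU Up (fun=> sA c d 1).
  move=> v v0; exists tt; apply: contra v0 => /eqP dv0; apply/eqP.
  by apply: (injA c d cp dp); rewrite dv0 linear0.
exists k => //; have [[Y Z] [/= Yp Zp] YZ] := kA.
have : \forall q \near p,
    (dom AS c `&` A @^-1` dom AX d) q /\ (Y `&` Z) (coord AS c q).
  apply: filterI; first by apply: open_nbhs_nbhs; split.
  exact: (coord_continuous cp (filterI Yp Zp)).
rewrite -nbhs_nearE nbhsE => -[U [oU' Up'] UYZ]; exists U => // x y Ux Uy.
have [[cx dx] [Yx _]] := UYZ _ Ux; have [[cy dy] [_ Zy]] := UYZ _ Uy.
split => //; have [->|xy] := eqVneq (coord AS c x) (coord AS c y).
  by rewrite subrr normr0 mulr0.
have /= /(_ xy)[_] := YZ (_, _) (conj Yx Zy).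
by rewrite /local_rep /= !coordK.
Qed.

Lemma split_injective_of_lower_bound c0 d0 (k : R) p :
  smooth_map AS AX A -> 0 < k -> dom AS c0 p -> dom AX d0 (A p) ->
  (\forall q \near p, k * `|coord AS c0 q - coord AS c0 p| <=
     `|coord AX d0 (A q) - coord AX d0 (A p)|) ->
  split_injective_differential AS AX A p.
Proof.
move=> sA k0 c0p d0p kA c d cp dp.
have [L1 L10 cL] := chart_change_lipschitz c0p cp.
have [L2 L20 dL] := chart_change_lipschitz dp d0p.
have dLA : \forall q \near p, `|coord AX d0 (A q) - coord AX d0 (A p)| <=
    L2 * `|coord AX d (A q) - coord AX d (A p)|.
  by have [cA _] := sA; exact: (cA p _ dL).
have kLA : \forall q \near p, k * `|coord AS c q - coord AS c p| <=
    L1 * L2 * `|coord AX d (A q) - coord AX d (A p)|.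
  near=> q.
  have h1 : `|coord AS c q - coord AS c p| <=
    L1 * `|coord AS c0 q - coord AS c0 p| by near: q.
  have h2 : k * `|coord AS c0 q - coord AS c0 p| <=
     `|coord AX d0 (A q) - coord AX d0 (A p)| by near: q.
  have h3 : `|coord AX d0 (A q) - coord AX d0 (A p)| <=
    L2 * `|coord AX d (A q) - coord AX d (A p)| by near: q.
  apply: (le_trans (ler_wpM2l (ltW k0) h1)); rewrite mulrCA -mulrA.
  by rewrite ler_wpM2l ?(ltW L10)// (le_trans h2).
(* Changing the source chart costs the factor [L1], changing the target chart the factor [L2]. *)
have e0 : 0 < k / (L1 * L2) by rewrite divr_gt0// mulr_gt0.
apply: (linear_left_inverse e0); apply: diff_norm_ge.
  exact: smooth_map_differentiable.
have := near_chart cp kLA; apply: filterS => y [cy yE].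
rewrite yE => kL; rewrite /local_rep /= coordK// mulrAC.
by rewrite ler_pdivrMr ?mulr_gt0// [leRHS]mulrC.
Unshelve. all: by end_near. Qed.

End charts.

Lemma inverse_continuous_of_lower_bound {R : realType} {S X : topologicalType}
    {V B : normedModType R} {OS : set S} {O : set X} (AS : atlas V OS)
    (AX : atlas B O) (A : S -> X) c d (k : R) (U : set S) (p0 : S) :
  0 < k -> continuous A ->
  (forall x y, U x -> U y -> [/\ dom AS c x, dom AX d (A x) &
    k * `|coord AS c x - coord AS c y|
      <= `|coord AX d (A x) - coord AX d (A y)|]) ->
  exists h : X -> S,
    (forall x, U x -> h (A x) = x) /\ {within A @` U, continuous h}.
Proof.
move=> k0 cA kU.
have injA x y : U x -> U y -> A x = A y -> x = y.
  move=> Ux Uy Axy; have [cx _] := kU _ _ Ux Uy; have [cy _ _] := kU _ _ Uy Ux.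
  rewrite Axy subrr normr0 pmulr_rle0// normr_le0 subr_eq0 => /eqP xy.
  by rewrite -(coordK cx) xy coordK.
(* The default [p0] is taken only off the image of [U], where continuity is not claimed. *)
pose h a := xget p0 [set x | U x /\ A x = a].
have hA x : U x -> h (A x) = x.
  move=> Ux; have : exists y, [set y | U y /\ A y = A x] y by exists x.
  by move=> /xgetPex-/(_ p0)[Uh /injA]; apply.
exists h; split => //; apply/subspace_continuousP => _ [x Ux <-] W.
rewrite /from_subspace hA// => Wx; have [cx dx _] := kU _ _ Ux Ux.
have [e /= e0 eW] : exists2 e : R, 0 < e &
    forall q, U q -> `|coord AS c q - coord AS c x| < e -> W q.
  have pW : nbhs (coord AS c x) (point AS c @^-1` W).
    have pc : point AS c y @[y --> coord AS c x] --> point AS c (coord AS c x).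
      by apply: point_continuous; exists x.
    by apply: pc; rewrite coordK.
  move/nbhs_normP : pW => [e /= e0 eW]; exists e => // q Uq qx.
  have [cq _ _] := kU _ _ Uq Uq.
  by rewrite -(coordK cq); apply: eW; rewrite /= distrC.
have dA : \forall a \near A x, `|coord AX d (A x) - coord AX d a| < k * e.
  have /cvgrPdist_lt := coord_continuous dx; apply; exact: mulr_gt0.
suff : \forall a \near A x, (A @` U) a -> W (h a) by [].
near=> a => -[q Uq qa]; rewrite -qa hA//; apply: eW => //.
rewrite -(ltr_pM2l k0); have [_ _ kq] := kU _ _ Uq Ux; apply: (le_lt_trans kq).
by rewrite distrC qa; near: a.
Unshelve. all: by end_near. Qed.

Lemma immersion_locally_embedding {R : realType} {S X : topologicalType}
    {s : nat} {B : normedModType R} {O : set X} (AS : manifold R S s)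
    (AX : atlas B O) (A : S -> X) (p : S) :
  smooth_map AS AX A -> O (A p) -> injective_differential AS AX A p ->
  exists2 U : set S, open U /\ U p & smooth_embedding_on AS AX U A.
Proof.
move=> sA OAp injA; have [cA sAcd] := sA.
have [c cp] := dom_cover AS (I : [set: S] p).
have [d dp] := dom_cover AX OAp.
have [k k0 [U [oU Up] kU]] := immersion_lower_bound sA injA cp dp.
exists U => //; split.
- by move=> _ [x Ux <-]; have [_ dx _] := kU _ _ Ux Ux; exact: dom_sub dx.
- by move=> x _; exact: cA.
- move=> c' d'; apply: smooth_on_subset (sAcd c' d') => _ [x [[_ cx] dx] <-].
  by exists x.
- move=> x Ux; have [cx dx _] := kU _ _ Ux Ux.
  (* Injectivity of the differential is assumed at [p] only. The two-point bound, with one point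
     fixed at [x], supplies it at every [x] in [U]. *)
  apply: (split_injective_of_lower_bound sA k0 cx dx).
  have : \forall q \near x, U q by exact: open_nbhs_nbhs.
  by apply: filterS => q Uq; have [] := kU _ _ Uq Ux.
- exact: inverse_continuous_of_lower_bound kU.
Qed.

End auxiliary.

(** * The core analytical package of an Einstein family *)

Theorem theorem6p4 (R : realType)
  (* Lie group, compact source, compact target, parameter manifold *)
  (G M N S : topologicalType) (l m n s : nat)
  (AG : manifold R G l) (mul : G -> G -> G) (inv : G -> G) (e : G)
  (AM : manifold R M m) (AN : manifold R N n) (AS : manifold R S s)
  (actM : G -> M -> M) (actN : G -> N -> N)
  (hG : is_lie_group AG mul inv e)
  (hM : hausdorff_space M) (cM : compact [set: M])
  (hN : hausdorff_space N) (cN : compact [set: N])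
  (hS : hausdorff_space S) (cS : @second_countable S)
  (hactM : smooth_action AG mul e AM actM)
  (hcoh : cohomogeneity_one AG e AM actM)
  (hactN : smooth_action AG mul e AN actN)
  (* the Einstein family, normalized by the geodesic gam *)
  (lambda len : R) (lambda_gt0 : 0 < lambda) (len_gt0 : 0 < len)
  (gam : R -> M) (hgam : smooth_curve AM gam)
  (p0 : S) (g : S -> M -> idx AM -> 'M[R]_m)
  (hg : normalized_einstein_family AG e AS actM lambda len gam g)
  (* the probe *)
  (h : N -> idx AN -> 'M[R]_n) (hh : riemannian h)
  (hh_inv : forall t, preserves (actN t) h)
  (k : nat) (alpha : R) (k_ge4 : (4 <= k)%N) (halpha : 0 < alpha < 1)
  (adm : set (M -> N)) (C2 C0 : (M -> N) -> set (M -> idx AN -> 'rV[R]_n))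
  (f : S -> M -> N)
  (hf : harmonic_family AS actM actN k alpha p0 g h adm f)
  (* Jacobi operators and Green operators *)
  (E F : completeNormedModType R)
  (Phi : S -> E -> M -> idx AN -> 'rV[R]_n)
  (Psi : S -> F -> M -> idx AN -> 'rV[R]_n)
  (Jop : S -> {linear E -> F}) (Gop : S -> {linear F -> E})
  (hJG : jacobi_package AS actM actN k alpha g h f C2 C0 Phi Psi Jop Gop)
  (* the space of operator data and the core analytical package *)
  (X : topologicalType) (opdata : X -> (E -> F) * (F -> E))
  (opdata_inj : injective opdata)
  (A : S -> X)
  (hA : forall p, opdata (A p) = (Jop p : E -> F, Gop p : F -> E))
  (* X is a Banach manifold on the open neighbourhood O of A p0 *)
  (B : completeNormedModType R) (O : set X) (AX : atlas B O)
  (hO : O (A p0))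
  (hAsmooth : smooth_map AS AX A)
  (hD : injective_differential AS AX A p0) :
  exists2 U : set S, open U /\ U p0 &
    [/\ smooth_embedding_on AS AX U A,
        (forall p q, U p -> U q ->
           (Jop p : E -> F, Gop p : F -> E) = (Jop q : E -> F, Gop q : F -> E) ->
           p = q) &
        (metric_injective_near g p0 \/ metric_immersed_at AS g p0 ->
           exists2 U' : set S, [/\ open U', U' p0 & U' `<=` U] &
             forall p q, U' p -> U' q ->
               ((Jop p : E -> F, Gop p : F -> E) =
                  (Jop q : E -> F, Gop q : F -> E) <->
                same_tensor (g p) (g q)))].
Proof.
have [U [oU Up0] embA] := immersion_locally_embedding hAsmooth hO hD.
have JG_inj p q : U p -> U q ->
    (Jop p : E -> F, Gop p : F -> E) = (Jop q : E -> F, Gop q : F -> E) -> p = q.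
  (* The pair of operators determines [A p] because [opdata] is injective, and [r] recovers [p] from
     [A p]. *)
  have [_ _ _ _ [r [rA _]]] := embA.
  by move=> Up Uq; rewrite -!hA => /opdata_inj Apq; rewrite -(rA p)// Apq rA.
exists U => //; split => // inj_or_imm.
have [V [oV Vp0] injV] : metric_injective_near g p0.
  case: inj_or_imm => // imm.
  exact: immersed_metric_injective_near (family_smooth hg) imm.
(* On this intersection, equality of operators and equality of metrics each amount to [p = q]. *)
exists (U `&` V).
  by split; [exact: openI|split|move=> x []].
move=> p q [Up Vp] [Uq Vq]; split; first by move=> /JG_inj-> // x c _.
by move=> /injV->.
Qed.
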